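(* Let $n\geq 1$ and let $C\subseteq \mathbb{F}_2^n$ be a binary completely regular code of length $n$ with $|C|>1$ and minimum distance $\delta>\max\{2,n/2\}$. Then either $\delta=n$ and $C$ is equivalent to the binary repetition code $\{\mathbf{0},\mathbf{1}\}\subseteq\mathbb{F}_2^n$; or $(n,\delta)=(7,4)$ and $C$ is equivalent to the code $\mathcal{H}_E\subseteq\mathbb{F}_2^7$, where $\mathcal{H}_E$ is the $\mathbb{F}_2$-row space of the matrix $$H=\begin{pmatrix}1&0&0&1&0&1&1\\0&1&0&1&1&1&0\\0&0&1&0&1&1&1\end{pmatrix},$$ i.e. $\mathcal{H}_E=\{0000000,\,1001011,\,0101110,\,0010111,\,1100101,\,1011100,\,0111001,\,1110010\}$ (the zero word together with the seven weight-$4$ codewords of the $[7,4,3]$ Hamming code with parity check matrix $H$).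
   Context: A code of length $n$ is a subset of $\mathbb{F}_2^n$, viewed as the vertex set of the binary Hamming graph $\Gamma$ with the Hamming metric $d(\cdot,\cdot)$ (two vertices adjacent iff they differ in exactly one coordinate). $\mathbf{0}$ and $\mathbf{1}$ denote the all-zero and all-one vectors. The automorphism group of $\Gamma$ is generated by translations $x\mapsto x+a$ ($a\in\mathbb{F}_2^n$) and coordinate permutations; two codes are equivalent if some such automorphism maps one onto the other. The minimum distance $\delta$ of $C$ is the smallest distance between distinct codewords. For $\alpha\in\mathbb{F}_2^n$, $d(\alpha,C)=\min_{\beta\in C}d(\alpha,\beta)$; the covering radius $\rho$ is $\max_{\alpha}d(\alpha,C)$, and $C_i=\{\alpha: d(\alpha,C)=i\}$. For a vertex $\nu$, $\Gamma_k(\nu)$ is the set of vertices at distance $k$ from $\nu$. The code $C$ is completely regular if for every $i\in\{0,\dots,\rho\}$ and every $k$, the number $|\Gamma_k(\nu)\cap C|$ is the same for all $\nu\in C_i$ (depends only on $i$ and $k$). *)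

(* Defs.v *)
From mathcomp Require Import all_boot all_order all_fingroup all_algebra.

Set Implicit Arguments.
Unset Strict Implicit.
Unset Printing Implicit Defensive.

Import Order.TTheory GRing.Theory Num.Theory.
Local Open Scope ring_scope.

Definition hdist (n : nat) (x y : 'rV['F_2]_n) : nat :=
  #|[set i : 'I_n | x ord0 i != y ord0 i]|.

(* Every Hamming distance is at most n, so the default value n of the two
   minima below only matters when the index set is empty. *)
Definition min_dist (n : nat) (C : {set 'rV['F_2]_n}) : nat :=
  \big[minn/n]_(x in C) \big[minn/n]_(y in C | y != x) hdist x y.

Definition dist_code (n : nat) (C : {set 'rV['F_2]_n}) (a : 'rV['F_2]_n) : nat :=
  \big[minn/n]_(b in C) hdist a b.

Definition covering_radius (n : nat) (C : {set 'rV['F_2]_n}) : nat :=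
  (\max_(a : 'rV['F_2]_n) dist_code C a)%N.

Definition code_layer (n : nat) (C : {set 'rV['F_2]_n}) (i : nat) :
    {set 'rV['F_2]_n} :=
  [set a | dist_code C a == i].

Definition sphere (n : nat) (v : 'rV['F_2]_n) (k : nat) : {set 'rV['F_2]_n} :=
  [set x | hdist v x == k].

Definition completely_regular (n : nat) (C : {set 'rV['F_2]_n}) : Prop :=
  forall i k : nat, (i <= covering_radius C)%N ->
  {in code_layer C i &, forall v w : 'rV['F_2]_n,
    #|sphere v k :&: C| = #|sphere w k :&: C|}.

Definition translation (n : nat) (a : 'rV['F_2]_n) : {perm 'rV['F_2]_n} :=
  perm (addIr a).

Lemma col_perm_inj (n : nat) (s : 'S_n) :
  injective (@col_perm 'F_2 1 n s).
Proof.
by move=> x y /(congr1 (col_perm s^-1)); rewrite -!col_permM mulVg !col_perm1.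
Qed.

Definition coord_perm (n : nat) (s : 'S_n) : {perm 'rV['F_2]_n} :=
  perm (@col_perm_inj n s).

Definition hamming_aut (n : nat) : {set {perm 'rV['F_2]_n}} :=
  <<[set translation a | a : 'rV['F_2]_n] :|: [set coord_perm s | s : 'S_n]>>%g.

Definition code_equiv (n : nat) (C D : {set 'rV['F_2]_n}) : Prop :=
  exists2 f : {perm 'rV['F_2]_n}, f \in hamming_aut n & f @: C = D.

Definition repetition_code (n : nat) : {set 'rV['F_2]_n} := [set 0; const_mx 1].

Definition H_mx : 'M['F_2]_(3, 7) :=
  \matrix_(i < 3, j < 7)
    nth 0 (nth [::] [:: [:: 1; 0; 0; 1; 0; 1; 1];
                        [:: 0; 1; 0; 1; 1; 1; 0];
                        [:: 0; 0; 1; 0; 1; 1; 1]] i) j.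

Definition H_E : {set 'rV['F_2]_7} := [set x | (x <= H_mx)%MS].

(* Main.v *)
(** Fix a codeword [x]. Complete regularity makes the supports of the differences
    between [x] and the codewords at distance [k := min_dist C] from it into a
    [t]-design on the coordinates for every [t <= k / 2]: a word obtained by
    flipping [t] coordinates of [x] lies in the layer [C_t], and the codewords at
    distance [k - t] from it are those whose support contains the flipped
    coordinates. Two such blocks meet in at most [k / 2] points.

    Unless [k = n], let [b], [r], [lambda] be the numbers of blocks, of blocks
    through a point and of blocks through two points. For [k >= 4] the design is a
    2-design, and the variance of the intersection sizes with a fixed block gives
    Fisher's inequality [r >= k]; the mean intersection size being at most [k / 2]
    gives [r (2k - n) <= k]. Hence [n = 2k - 1], [r = k], [b = n], every two
    blocks meet in exactly [k / 2] points and [lambda = k / 2]. If [k >= 6], the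
    design is a 3-design, and then [4 lambda - 3] divides [3], which is absurd. So
    [k = 4], [n = 7], and three blocks that are not of the form [u], [v], [u + v]
    determine, up to a permutation of the coordinates, all the others. *)
Require Import Defs.
From mathcomp Require Import all_boot all_order all_fingroup all_algebra.
From mathcomp Require Import zify ring.

Set Implicit Arguments.
Unset Strict Implicit.
Unset Printing Implicit Defensive.

Import Order.TTheory GRing.Theory Num.Theory.
Local Open Scope ring_scope.

(** * Double counting in a family of sets *)

Section BlockDegrees.
Local Open Scope nat_scope.
Variable T : finType.
Implicit Types (B : {set {set T}}) (P S : {set T}).

Definition degree B P : nat := #|[set b in B | P \subset b]|.

Lemma degreeE B P : degree B P = \sum_(b in B) (P \subset b).
Proof.
rewrite /degree -sum1_card big_mkcond [RHS]big_mkcond; apply: eq_bigr => b _.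
by rewrite inE; case: (b \in B); case: (P \subset b).
Qed.

Lemma degree0 B : degree B set0 = #|B|.
Proof. by apply: eq_card => b; rewrite inE sub0set andbT. Qed.

(** Both sides count the pairs of a block [b] containing [P] and a point of [b] outside [P]. *)
Lemma sum_degreeU1 B P k : {in B, forall b : {set T}, #|b| = k} ->
  \sum_(x in ~: P) degree B (x |: P) = degree B P * (k - #|P|).
Proof.
move=> Bk; under eq_bigr do rewrite degreeE.
rewrite exchange_big degreeE big_distrl /=; apply: eq_bigr => b Bb.
under eq_bigr do rewrite subUset sub1set.
case: (boolP (P \subset b)) => Pb; last first.
  by rewrite big1 // => x _; rewrite andbF.
rewrite mul1n -(Bk b Bb) -cardsDS // -sum1_card big_mkcond [RHS]big_mkcond.
by apply: eq_bigr => x _; rewrite !inE andbT; case: (x \in P); case: (x \in b).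
Qed.

Lemma sum_cardI B S :
  \sum_(b in B) #|S :&: b| = \sum_(p in S) degree B [set p].
Proof.
under [RHS]eq_bigr do rewrite degreeE.
rewrite exchange_big; apply: eq_bigr => b _.
rewrite -sum1_card big_mkcond [RHS]big_mkcond; apply: eq_bigr => x _.
by rewrite !inE sub1set; case: (x \in S); case: (x \in b).
Qed.

(** Both sides count triples of a block and an ordered pair of points, possibly equal, of its trace
    on [S]. *)
Lemma sum_sqr_cardI B S :
  \sum_(b in B) #|S :&: b| ^ 2 =
  \sum_(p in S) \sum_(q in S) degree B [set p; q].
Proof.
have cardIE b : #|S :&: b| = \sum_(x in S) (x \in b).
  rewrite -sum1_card big_mkcond [RHS]big_mkcond; apply: eq_bigr => x _.
  by rewrite !inE; case: (x \in S); case: (x \in b).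
under eq_bigr do rewrite cardIE -mulnn big_distrl /=.
rewrite exchange_big; apply: eq_bigr => p _.
under eq_bigr do rewrite big_distrr /=.
rewrite exchange_big; apply: eq_bigr => q _.
rewrite degreeE; apply: eq_bigr => b _.
by rewrite subUset !sub1set; case: (p \in b); case: (q \in b).
Qed.

End BlockDegrees.

(** * Degrees and intersection moments in designs *)

Section Designs.
Local Open Scope nat_scope.
Variables (T : finType) (B : {set {set T}}) (k : nat).
Implicit Types (P Q S : {set T}).

(** For blocks of constant size, this is the defining property of a [t]-design. *)
Definition balanced t := forall P Q : {set T}, #|P| = t -> #|Q| = t ->
  degree B P = degree B Q.

Hypothesis Bk : {in B, forall b : {set T}, #|b| = k}.

(** The classical recursion between the parameters of a design: all summands of [sum_degreeU1] are
    equal. *)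
Lemma balanced_degreeS P x : balanced #|P|.+1 -> x \notin P ->
  (#|T| - #|P|) * degree B (x |: P) = degree B P * (k - #|P|).
Proof.
move=> bal xP; rewrite -(sum_degreeU1 _ Bk).
rewrite (eq_bigr (fun=> degree B (x |: P))); last first.
  by move=> y; rewrite inE => yP; apply: bal; rewrite cardsU1 ?yP ?xP.
by rewrite sum_nat_const -(cardsC P) addKn.
Qed.

Lemma balanced_sum_cardI p S : balanced 1 ->
  \sum_(b in B) #|S :&: b| = #|S| * degree B [set p].
Proof.
move=> bal; rewrite sum_cardI -sum_nat_const; apply: eq_bigr => q _.
by apply: bal; rewrite cards1.
Qed.

Lemma balanced_sum_sqr_cardI p q S : balanced 1 -> balanced 2 -> p != q ->
  \sum_(b in B) #|S :&: b| ^ 2 =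
  #|S| * degree B [set p] + #|S| * (#|S| - 1) * degree B [set p; q].
Proof.
move=> bal1 bal2 npq; rewrite sum_sqr_cardI -mulnA -mulnDr -sum_nat_const.
apply: eq_bigr => x xS; rewrite (bigD1 x) //= setUid; congr (_ + _).
  by apply: bal1; rewrite !cards1.
rewrite (eq_bigr (fun=> degree B [set p; q])); last first.
  by move=> y /andP[_ yx]; apply: bal2; rewrite cards2 ?npq // eq_sym yx.
rewrite sum_nat_const; congr (_ * _); rewrite (cardsD1 x S) xS add1n subn1 /=.
by apply: eq_card => y; rewrite !inE andbC.
Qed.


End Designs.

(** * Arithmetic of the design parameters *)

Section Counting.
Local Open Scope nat_scope.

(** Cauchy-Schwarz, by summing [2 f(i) f(j) <= f(i)^2 + f(j)^2] over all pairs. *)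
Lemma sum_sqr_leq (I : finType) (A : {set I}) (f : I -> nat) :
  (\sum_(i in A) f i) ^ 2 <= #|A| * \sum_(i in A) f i ^ 2.
Proof.
have -> : #|A| * \sum_(i in A) f i ^ 2 = \sum_(i in A) \sum_(j in A) f j ^ 2.
  by rewrite sum_nat_const.
rewrite -mulnn big_distrl /= -(leq_pmul2l (isT : 0 < 2)).
have -> : 2 * \sum_(i in A) \sum_(j in A) f j ^ 2 =
    \sum_(i in A) \sum_(j in A) (f i ^ 2 + f j ^ 2).
  under [RHS]eq_bigr do rewrite big_split.
  rewrite big_split /= [X in _ = X + _]exchange_big /=.
  by rewrite mul2n addnn.
rewrite big_distrr; apply: leq_sum => i _ /=.
by rewrite big_distrr /= big_distrr; apply: leq_sum => j _; apply: nat_Cauchy.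
Qed.

(* [s1] and [s2] are the sums of the sizes, and of the squared sizes, of the
   intersections of a fixed block with the [b - 1] others; their variance times
   [n - 1] equals [(n - k)^2 r (r - k)]. *)
Lemma fisher_arith (n k b r l s1 s2 : nat) : 0 < k < n -> 0 < r -> 0 < b ->
  n * r = b * k -> (n - 1) * l = r * (k - 1) ->
  k + s1 = k * r -> k ^ 2 + s2 = k * r + k * (k - 1) * l ->
  s1 ^ 2 <= (b - 1) * s2 -> k <= r.
Proof.
case: k => // k; case: n => // n; case: b => // b; case: r => // r.
rewrite !subSS !subn0 -!mulnn => kn _ _ e1 e2 e3 e4 h.
rewrite leqNgt; apply/negP => rk.
(* [k], [n], [b] and [r] are now the predecessors of the original parameters, hence the shifts by 1
   below; [l] is unchanged. *)
pose K : int := k; pose N : int := n; pose R : int := r; pose L : int := l.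
have S1 : (s1%:Z = (K + 1) * R)%R by lia.
have S2 : (s2%:Z = (K + 1) * (R + 1 + K * L - (K + 1)))%R by lia.
have E1 : ((b%:Z + 1) * (K + 1) = (N + 1) * (R + 1))%R by lia.
have E2 : (N * L = (R + 1) * K)%R by lia.
have key : (N * (b%:Z * s2%:Z - s1%:Z ^+ 2) =
            (N - K) ^+ 2 * (R + 1) * (R - K))%R.
  transitivity (((b%:Z + 1) * (K + 1) - (K + 1)) *
      (N * (R - K) + K * (N * L)) - N * ((K + 1) * R) ^+ 2)%R.
    by rewrite S1 S2; ring.
  by rewrite E1 E2; ring.
have : (0 <= N * (b%:Z * s2%:Z - s1%:Z ^+ 2))%R.
  by apply: mulr_ge0; [lia|rewrite expr2 subr_ge0; lia].
rewrite key; apply/negP; rewrite -ltNge nmulr_llt0; last by lia.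
by apply: mulr_gt0; [apply: exprn_gt0|]; lia.
Qed.

(* The equation between [lambda = l] and [lambda_3 = m]; times [8], it reads
   [8 M m = M^2 + 2 M - 3] with [M = 4 l - 3]. *)
Lemma triple_degree_arith (l m : nat) : 3 <= l ->
  (2 * (2 * l) - 1 - 2) * m <> l * (2 * l - 2).
Proof.
move=> l3; have [u ->] : exists u, l = u + 3 by exists (l - 3); lia.
have -> : 2 * (2 * (u + 3)) - 1 - 2 = 4 * u + 9 by lia.
have -> : 2 * (u + 3) - 2 = 2 * u + 4 by lia.
move=> e; suff /dvdn_leq : 4 * u + 9 %| 3 by move/(_ isT); lia.
rewrite [X in _ %| X](_ : _ = (4 * u + 9) * (4 * u + 11 - 8 * m)).
  exact: dvdn_mulr.
by rewrite mulnBr; lia.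
Qed.

End Counting.

(** * Parameters of a design whose blocks exceed half of the points *)

Section LargeBlocks.
Local Open Scope nat_scope.
Variables (T : finType) (B : {set {set T}}) (k : nat).
Implicit Types (b c : {set T}).

Hypothesis Bk : {in B, forall b : {set T}, #|b| = k}.
Hypothesis Bbal : forall t, t.*2 <= k -> balanced B t.
Hypothesis Bcap :
  {in B &, forall b c : {set T}, b != c -> (#|b :&: c|).*2 <= k}.
Hypothesis kT : k < #|T|.

Lemma sum_cardI_others b : b \in B ->
  k + \sum_(c in B :\ b) #|b :&: c| = \sum_(c in B) #|b :&: c|.
Proof.
move=> Bb; rewrite [RHS](bigD1 b) //= setIid Bk //; congr (_ + _).
by apply: eq_bigl => c; rewrite !inE andbC.
Qed.

Lemma sum_sqr_cardI_others b : b \in B ->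
  k ^ 2 + \sum_(c in B :\ b) #|b :&: c| ^ 2 = \sum_(c in B) #|b :&: c| ^ 2.
Proof.
move=> Bb; rewrite [RHS](bigD1 b) //= setIid Bk //; congr (_ + _).
by apply: eq_bigl => c; rewrite !inE andbC.
Qed.

Lemma sum_cardI_others_leq b : b \in B ->
  \sum_(c in B :\ b) #|b :&: c| <= #|B :\ b| * k./2.
Proof.
move=> Bb; rewrite -sum_nat_const; apply: leq_sum => c /setD1P[cb Bc].
by rewrite geq_half_double Bcap // eq_sym.
Qed.

Lemma degree_point p : 2 <= k -> #|T| * degree B [set p] = #|B| * k.
Proof.
move=> k2; have := @balanced_degreeS _ _ _ Bk set0 p.
by rewrite cards0 !subn0 setU0 degree0 inE => -> //; apply: Bbal.
Qed.

Lemma degree_pair p q : 4 <= k -> p != q ->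
  (#|T| - 1) * degree B [set p; q] = degree B [set p] * (k - 1).
Proof.
move=> k2 pq; have := @balanced_degreeS _ _ _ Bk [set q] p.
rewrite cards1 inE pq => -> //; last exact: Bbal.
by congr (_ * _); apply: (@Bbal 1); rewrite ?cards1 //; lia.
Qed.

Lemma degree_triple p q s : 6 <= k -> p != q -> s \notin [set p; q] ->
  (#|T| - 2) * degree B (s |: [set p; q]) = degree B [set p; q] * (k - 2).
Proof.
move=> k6 pq spq; have := @balanced_degreeS _ _ _ Bk [set p; q] s.
by rewrite cards2 pq spq => -> //; exact: Bbal.
Qed.

Lemma exists_flag b : b \in B -> 0 < k ->
  exists2 p, p \in b & 0 < degree B [set p].
Proof.
move=> Bb k0; have /card_gt0P[p pb] : 0 < #|b| by rewrite Bk.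
by exists p => //; apply/card_gt0P; exists b; rewrite inE Bb sub1set.
Qed.

(** Only 1-balance is available for [k = 3]. Here [n] is 4 or 5 and blocks meet in at most one
    point, so [3 r - 3 <= b - 1] with [n r = 3 b]. This forces [r = 1], and then 3 would divide
    [n]. *)
Lemma block_size_neq3 b : b \in B -> #|T| < k.*2 -> k <> 3.
Proof.
move=> Bb kn k3.
have [|p pb dp] := exists_flag Bb; first by rewrite k3.
have := degree_point p; rewrite k3 => /(_ isT) e.
have := sum_cardI_others_leq Bb; rewrite k3 /= muln1.
have := sum_cardI_others Bb.
rewrite [X in _ = X -> _](balanced_sum_cardI p); last by apply: Bbal; rewrite k3.
rewrite Bk // k3.
have := cardsD1 b B; rewrite Bb.
move: kT kn e; rewrite k3.
set n := #|T|; set x := degree _ _ in dp *; set y := #|B|.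
set z := #|B :\ b|; set s := \sum_(_ in _) _.
have [->|] := eqVneq n 4; first by lia.
by move=> n4 n3 n6; have -> : n = 5; lia.
Qed.

Lemma design_parameters b : b \in B -> 2 < k -> #|T| < k.*2 ->
  [/\ k = 4, #|T| = 7, #|B| = 7,
      forall p, degree B [set p] = 4 &
      {in B &, forall c d, c != d -> #|c :&: d| = 2}].
Proof.
move=> Bb k2 nk.
have k4 : 4 <= k by have := block_size_neq3 Bb nk; lia.
have [|p pb r0] := exists_flag Bb; first by lia.
have /card_gt0P[q] : 0 < #|b :\ p|.
  by have := cardsD1 p b; rewrite pb Bk //; lia.
rewrite 2!inE => /andP[qp qb]; rewrite eq_sym in qp.
have bal1 : balanced B 1 by apply: Bbal; lia.
have bal2 : balanced B 2 by apply: Bbal; lia.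
have e1 := degree_point p (ltnW k2).
have e2 := degree_pair k4 qp.
set r := degree B [set p] in r0 e1 e2; set l := degree B [set p; q] in e2.
have s1E c (Bc : c \in B) : k + \sum_(d in B :\ c) #|c :&: d| = k * r.
  by rewrite sum_cardI_others // (balanced_sum_cardI p) // Bk.
have s2E :
    k ^ 2 + \sum_(d in B :\ b) #|b :&: d| ^ 2 = k * r + k * (k - 1) * l.
  rewrite sum_sqr_cardI_others //.
  by rewrite (balanced_sum_sqr_cardI (p := p) (q := q)) // Bk.
have cB c (Bc : c \in B) : #|B :\ c| = #|B| - 1.
  by rewrite (cardsD1 c B) Bc addKn.
have B0 : 0 < #|B| by apply/card_gt0P; exists b.
have kr : k <= r.
  apply: (fisher_arith _ r0 B0 e1 e2 (s1E b Bb) s2E); first by rewrite kT; lia.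
  by have := sum_sqr_leq (B :\ b) (fun d => #|b :&: d|); rewrite cB.
have s1h : 2 * \sum_(d in B :\ b) #|b :&: d| <= (#|B| - 1) * k.
  apply: leq_trans (_ : 2 * (#|B :\ b| * k./2) <= _).
    by rewrite leq_pmul2l //; apply: sum_cardI_others_leq.
  by rewrite cB // mulnCA leq_mul2l; lia.
(* Twice the sum of the intersections is [2 k r - 2 k], and [(b - 1) k = n r - k]. *)
have rk : (2 * k - #|T|) * r <= k.
  have := s1E b Bb; move: s1h e1 B0; rewrite !mulnBl mul1n => *; lia.
(* As [r >= k] and [2 k - n > 0], the bound [rk] leaves only [2 k - n = 1]. *)
have n1 : #|T| = 2 * k - 1 by nia.
have rE : r = k.
  apply/eqP; rewrite eqn_leq kr andbT; move: rk; rewrite n1.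
  by rewrite subKn ?mul1n //; lia.
have lE : 2 * l = k.
  have k1 : 0 < k - 1 by lia.
  apply/eqP; rewrite -(eqn_pmul2r k1); apply/eqP.
  move: e2; rewrite rE n1 => <-.
  by rewrite (_ : 2 * k - 1 - 1 = 2 * (k - 1)) 1?mulnAC //; clear - k2; lia.
have BE : #|B| = 2 * k - 1.
  have k0 : 0 < k by lia.
  by apply/eqP; rewrite -(eqn_pmul2r k0) -e1 rE n1.
have k6 : ~ 6 <= k.
  move=> k6; have /card_gt0P[s] : 0 < #|~: [set p; q]|.
    by have := cardsC [set p; q]; rewrite cards2 qp; lia.
  rewrite inE => spq; have := degree_triple k6 qp spq.
  rewrite -/l n1 -lE; set m := degree _ _ => e3.
  by apply: (triple_degree_arith _ e3); clear - k6 lE; lia.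
(* [k] is even by [lE], which excludes 5. *)
have k4E : k = 4 by lia.
clear e1 e2 s2E s1h rk.
split; rewrite ?n1 ?BE ?k4E //.
  by move=> x; rewrite -k4E -rE; apply: bal1; rewrite cards1.
move=> c d Bc Bd cd.
have cap2 e : e \in B :\ c -> #|c :&: e| <= 2.
  move=> /setD1P[ec Be]; rewrite -leq_double.
  by apply: leq_trans (Bcap Bc Be _) _; rewrite 1?eq_sym ?k4E.
apply/eqP; rewrite eqn_leq cap2 /=; last by rewrite !inE eq_sym cd.
(* The six intersections with [c] sum to [4 * 4 - 4 = 12] and none exceeds 2, so none can be
   smaller. *)
rewrite leqNgt; apply/negP => cd1; have := s1E c Bc; rewrite (bigD1 d) /=; last first.
  by rewrite !inE eq_sym cd.
suff : \sum_(i in B :\ c | i != d) #|c :&: i| <= 5 * 2.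
  move: cd1; rewrite rE k4E; set S := \sum_(i in _ | _) _.
  by clearbody S; clear; lia.
have -> : 5 = #|(B :\ c) :\ d|.
  by have := cardsD1 d (B :\ c); rewrite !inE eq_sym cd Bd cB // BE k4E; lia.
rewrite -sum_nat_const; under eq_bigl => i do rewrite andbC -in_setD1.
by apply: leq_sum => e /setD1P[_]; exact: cap2.
Qed.

End LargeBlocks.

(** * Binary words and their difference supports *)

Lemma F2_neq_addb (a b c : 'F_2) : (b != c) = (a != b) (+) (a != c).
Proof. by case: a b c => [[|[]]] // ? [[|[]]] // ? [[|[]]]. Qed.

Lemma F2_neqE (a b c : 'F_2) : (a != b) = (a != c) -> b = c.
Proof.
by move=> e; apply/eqP; rewrite -[_ == _]negbK (F2_neq_addb a) e addbb.
Qed.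

Lemma F2_addE (a b : 'F_2) : b + a = (a != b)%:R.
Proof. by case: a b => [[|[]]] // ? [[|[]]] // ?; apply/val_inj. Qed.

Section Support.
Variable n : nat.
Implicit Types (x y z : 'rV['F_2]_n) (P : {set 'I_n}).

Definition supp x y : {set 'I_n} := [set i | x ord0 i != y ord0 i].

Definition flip x P : 'rV['F_2]_n := \row_i (x ord0 i + (i \in P)%:R).

Lemma suppC x y : supp x y = supp y x.
Proof. by apply/setP => i; rewrite !inE eq_sym. Qed.

Lemma supp_inj x : injective (supp x).
Proof.
move=> y z /setP e; apply/rowP => i; apply: (@F2_neqE (x ord0 i)).
by have := e i; rewrite !inE.
Qed.

Lemma supp_flip x P : supp x (flip x P) = P.
Proof.
apply/setP => i; rewrite !inE mxE -[X in X == _]addr0 (inj_eq (addrI _)).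
by case: (i \in P).
Qed.

Lemma hdist_flipr x P : hdist x (flip x P) = #|P|.
Proof. by rewrite /hdist -/(supp _ _) supp_flip. Qed.

Lemma hdistxx x : hdist x x = 0%N.
Proof. by apply/eqP; rewrite cards_eq0; apply/eqP/setP => i; rewrite !inE eqxx. Qed.

Lemma hdistC x y : hdist x y = hdist y x.
Proof. by rewrite /hdist -/(supp x y) suppC. Qed.

Lemma hdist_le x y : (hdist x y <= n)%N.
Proof. by rewrite -[leqRHS]card_ord max_card. Qed.

(** [supp y z] is the symmetric difference of [supp x y] and [supp x z]. *)
Lemma hdist_cardI x y z :
  (hdist y z + (#|supp x y :&: supp x z|).*2 = hdist x y + hdist x z)%N.
Proof.
rewrite /hdist -!sum1_card !(big_mkcond (fun i => i \in _)) -addnn -!big_split.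
apply: eq_bigr => i _ /=.
rewrite !inE (F2_neq_addb (x ord0 i) (y ord0 i)).
by case: eqP => _; case: eqP.
Qed.

End Support.

(** * From complete regularity to designs *)

Section MinimumDistance.
Local Open Scope nat_scope.

Lemma bigminn_leq (I : finType) (P : pred I) (F : I -> nat) m i :
  P i -> \big[minn/m]_(j | P j) F j <= F i.
Proof.
move=> Pi; elim: (index_enum I) (mem_index_enum i) => //= j s IHs.
rewrite inE big_cons => /predU1P[<-|/IHs le_s]; first by rewrite Pi geq_minl.
by case: (P j) => //; apply: leq_trans le_s; apply: geq_minr.
Qed.

Lemma bigminn_geq (I : finType) (P : pred I) (F : I -> nat) m k :
  k <= m -> (forall i, P i -> k <= F i) -> k <= \big[minn/m]_(j | P j) F j.
Proof.
by move=> km kF; elim/big_ind: _ => // a b ka kb; rewrite leq_min ka.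
Qed.

(** A value below the default [m] must come from a term. *)
Lemma bigminn_attained (I : finType) (P : pred I) (F : I -> nat) m :
  \big[minn/m]_(j | P j) F j < m ->
  exists2 i, P i & F i = \big[minn/m]_(j | P j) F j.
Proof.
elim/big_ind: _ => [|a b IHa IHb|i Pi _]; first by rewrite ltnn.
  by rewrite /minn; case: (ltnP a b).
by exists i.
Qed.

Variables (n : nat) (C : {set 'rV['F_2]_n}).

Lemma min_dist_leq x y : x \in C -> y \in C -> x != y ->
  min_dist C <= hdist x y.
Proof.
move=> Cx Cy xy; apply: leq_trans (bigminn_leq _ _ Cx) _.
by apply: bigminn_leq; rewrite Cy eq_sym.
Qed.

Lemma min_dist_attained : min_dist C < n ->
  exists x y, [/\ x \in C, y \in C & hdist x y = min_dist C].
Proof.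
move=> ltn; have [x Cx ex] := bigminn_attained ltn.
move: ltn; rewrite /min_dist -ex => /bigminn_attained[y /andP[Cy yx] ey].
by exists x, y; split=> //; rewrite ey.
Qed.

Lemma dist_codeE x a : x \in C ->
  (forall y, y \in C -> hdist a x <= hdist a y) -> dist_code C a = hdist a x.
Proof.
move=> Cx min_x; apply/eqP; rewrite eqn_leq bigminn_leq //=.
by apply: bigminn_geq => //; apply: hdist_le.
Qed.

Definition blocks x : {set {set 'I_n}} :=
  [set supp x y | y in [set y in C | hdist x y == min_dist C]].

Lemma card_blocks x b : b \in blocks x -> #|b| = min_dist C.
Proof. by case/imsetP => y; rewrite inE => /andP[_ /eqP<-] ->. Qed.

(** Two such codewords are at distance [2 k - 2 |b :&: c|], which is at least [k]. *)
Lemma blocks_cap x b c : b \in blocks x -> c \in blocks x -> b != c ->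
  (#|b :&: c|).*2 <= min_dist C.
Proof.
move=> /imsetP[y + ->] /imsetP[z + ->]; rewrite !inE.
move=> /andP[Cy /eqP dy] /andP[Cz /eqP dz] yz.
have := hdist_cardI x y z; rewrite dy dz.
suff: min_dist C <= hdist y z by lia.
by apply: min_dist_leq => //; apply: contraNneq yz => ->.
Qed.

Lemma hdist_flip x y (P : {set 'I_n}) :
  hdist (flip x P) y + (#|P :&: supp x y|).*2 = #|P| + hdist x y.
Proof. by rewrite -{2}(supp_flip x P) hdist_cardI hdist_flipr. Qed.

(** Any other codeword is at distance at least [k - |P| >= |P|] from the flipped word, by the
    triangle inequality. *)
Lemma dist_code_flip x (P : {set 'I_n}) : x \in C -> (#|P|).*2 <= min_dist C ->
  dist_code C (flip x P) = #|P|.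
Proof.
move=> Cx lePC.
have dx : hdist (flip x P) x = #|P| by rewrite hdistC hdist_flipr.
rewrite -[RHS]dx; apply: dist_codeE => // y Cy; rewrite dx.
have [->|yx] := eqVneq y x; first by rewrite dx.
have := hdist_flip x y P; have := subset_leq_card (subsetIl P (supp x y)).
by have := min_dist_leq Cx Cy; rewrite eq_sym yx => /(_ isT); lia.
Qed.

(* For [t = k / 2], the word [x] is itself at distance [k - t]. *)
Lemma card_sphere_flip x (P : {set 'I_n}) t : #|P| = t ->
  x \in C -> 0 < min_dist C -> t.*2 <= min_dist C ->
  #|sphere (flip x P) (min_dist C - t) :&: C| =
  degree (blocks x) P + (t.*2 == min_dist C).
Proof.
move=> Pt Cx d0 lePC.
pose N := [set y in C | (hdist x y == min_dist C) && (P \subset supp x y)].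
have -> : degree (blocks x) P = #|N|.
  rewrite /degree -(card_imset _ (@supp_inj _ x)); apply: eq_card => b.
  apply/idP/imsetP => [|[y + ->]]; rewrite !inE.
    case/andP => /imsetP[y + ->] Py; rewrite inE => /andP[Cy dy].
    by exists y; rewrite // inE Cy dy.
  by case/and3P=> Cy dy Py; rewrite Py andbT imset_f // inE Cy.
have xN : x \notin N by rewrite inE hdistxx (ltn_eqF d0) andbF.
have -> : sphere (flip x P) (min_dist C - t) :&: C =
    if t.*2 == min_dist C then x |: N else N.
  apply/setP => y; have -> : (y \in (if t.*2 == min_dist C then x |: N else N)) =
    (y == x) && (t.*2 == min_dist C) || (y \in N).
    by case: ifP; rewrite ?inE ?andbT ?andbF.
  rewrite !inE; case Cy: (y \in C); last first.
    by rewrite andbF orbF; case: eqP => // yx; rewrite yx Cx in Cy.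
  rewrite andbT /=; have e := hdist_flip x y P; rewrite Pt in e.
  have [yx|yx] := eqVneq y x.
    rewrite yx hdistC hdist_flipr Pt hdistxx (ltn_eqF d0) orbF /=.
    by apply/eqP/eqP; lia.
  (* The distance to [y] is [t + hdist x y - 2 i] with [hdist x y >= k] and [i <= t]; it equals
     [k - t] exactly when both bounds are attained. *)
  have := min_dist_leq Cx Cy; rewrite eq_sym yx => /(_ isT) dxy.
  have capE : #|P :&: supp x y| <= t ?= iff (P \subset supp x y).
    rewrite -Pt; have := subset_leqif_cards (subsetIl P (supp x y)).
    by rewrite (sameP eqP setIidPl).
  rewrite -capE; have := capE.1; set i := #|P :&: _| in e *.
  by move=> iP; apply/eqP/andP => [e1|[/eqP e1 /eqP e2]];
    [split; apply/eqP|]; lia.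
by case: eqP => _; rewrite ?cardsU1 ?xN ?addn0 // addnC.
Qed.

Lemma blocks_balanced x t : completely_regular C -> x \in C ->
  0 < min_dist C -> t.*2 <= min_dist C -> balanced (blocks x) t.
Proof.
(* The correction term depends only on [t], so it cancels. *)
move=> cr Cx d0 tC P Q Pt Qt; apply: (@addIn (t.*2 == min_dist C)).
rewrite -(card_sphere_flip Pt) // -(card_sphere_flip Qt) //.
have dP : dist_code C (flip x P) = t by rewrite dist_code_flip ?Pt.
apply: (cr t); rewrite ?inE ?dP ?dist_code_flip ?Qt //.
by rewrite -dP; apply: leq_bigmax.
Qed.

End MinimumDistance.

(** * Coordinates adapted to three independent blocks *)

Section Fano.
Local Open Scope nat_scope.

(** The columns of [H_mx] in order; each nonzero triple of bits occurs once. *)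
Definition H_columns : seq (bool * bool * bool) :=
  [:: (true, false, false); (false, true, false); (false, false, true);
      (true, true, false); (false, true, true); (true, true, true);
      (true, false, true)].

(** Let [t] be the size of the triple intersection. The cells in exactly one set have size [t],
    those in exactly two have size [2 - t], and the total 7 gives [t <= 1]. If [t = 0], then [w] is
    the symmetric difference of [u] and [v]; so [t = 1] and all seven cells are singletons. *)
Lemma venn_cells (T : finType) (u v w : {set T}) : #|T| = 7 ->
  #|u| = 4 -> #|v| = 4 -> #|w| = 4 ->
  #|u :&: v| = 2 -> #|u :&: w| = 2 -> #|v :&: w| = 2 ->
  w != (u :\: v) :|: (v :\: u) ->
  forall t, t != (false, false, false) ->
  exists i, (i \in u, i \in v, i \in w) = t.
Proof.
move=> cT cu cv cw cuv cuw cvw nw.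
pose N a b c := #|[set i | (i \in u, i \in v, i \in w) == (a, b, c)]|.
have split8 (A : {set T}) (g : bool -> bool -> bool -> bool) :
    (forall i, (i \in A) = g (i \in u) (i \in v) (i \in w)) ->
  #|A| = g false false false * N false false false
       + g false false true * N false false true
       + g false true false * N false true false
       + g false true true * N false true true
       + g true false false * N true false false
       + g true false true * N true false true
       + g true true false * N true true false
       + g true true true * N true true true.
  move=> Ag; rewrite /N -!sum1_card !(big_mkcond (fun i => i \in _)) /=.
  rewrite !big_distrr -!big_split; apply: eq_bigr => i _ /=; rewrite Ag !inE.
  by case: (i \in u); case: (i \in v); case: (i \in w); case: (g _ _ _);
     rewrite /= ?muln0 ?muln1.
have := split8 setT (fun _ _ _ => true) (fun i => in_setT i).
have := split8 u (fun a _ _ => a) (fun=> erefl).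
have := split8 v (fun _ a _ => a) (fun=> erefl).
have := split8 w (fun _ _ a => a) (fun=> erefl).
have := split8 (u :&: v) (fun a b _ => a && b) (fun i => in_setI i _ _).
have := split8 (u :&: w) (fun a _ b => a && b) (fun i => in_setI i _ _).
have := split8 (v :&: w) (fun _ a b => a && b) (fun i => in_setI i _ _).
rewrite cardsT cT cu cv cw cuv cuw cvw /=.
clear split8 => e1 e2 e3 e4 e5 e6 e7.
have N0 a b c : N a b c = 0 ->
    forall i, ((i \in u, i \in v, i \in w) == (a, b, c)) = false.
  by move=> /eqP; rewrite cards_eq0 => /eqP/setP N0 i; have := N0 i; rewrite !inE.
have N111 : N true true true != 0.
  apply: contraNneq nw => z.
  have /N0 z1 : N true false false = 0 by lia.
  have /N0 z2 : N false true false = 0 by lia.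
  have /N0 z3 : N false false true = 0 by lia.
  move/N0 in z; apply/eqP/setP => i; move: (z i) (z1 i) (z2 i) (z3 i).
  by rewrite !inE; case: (i \in u); case: (i \in v); case: (i \in w).
case=> [[a b] c] abc; have /card_gt0P[i] : 0 < N a b c.
  by move: abc; case: a; case: b; case: c => //= _; lia.
by rewrite inE => /eqP; exists i.
Qed.

Lemma H_coordinates (T : finType) (u v w : {set T}) : #|T| = 7 ->
  (forall t, t != (false, false, false) ->
    exists i, (i \in u, i \in v, i \in w) = t) ->
  exists2 s : 'I_7 -> T, injective s & forall j : 'I_7,
    (s j \in u, s j \in v, s j \in w) = nth (true, true, true) H_columns j.
Proof.
move=> cT cells.
have /fin_all_exists[s sE] (j : 'I_7) : exists i,
    (i \in u, i \in v, i \in w) = nth (true, true, true) H_columns j.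
  by apply: cells; case: j => [[|[|[|[|[|[|[|j]]]]]]] ltj].
exists s => // j1 j2 e; apply/ord_inj/eqP.
by rewrite -(nth_uniq (true, true, true) (s := H_columns)) // -!sE e.
Qed.

(** The first three columns of [H_mx] form the identity, so the first three bits are the
    coefficients of the rows. *)
Lemma H_E_bits (e : 'rV['F_2]_7) (f : nat -> bool) :
  (forall j : 'I_7, e ord0 j = (f j)%:R%R) ->
  [/\ f 3 = f 0 (+) f 1, f 4 = f 1 (+) f 2,
      f 5 = f 0 (+) f 1 (+) f 2 & f 6 = f 0 (+) f 2] -> e \in H_E.
Proof.
move=> ef [f3 f4 f5 f6]; rewrite inE; apply/submxP.
exists (\row_(i < 3) (f i)%:R)%R; apply/rowP => j; rewrite ef.
rewrite mxE !big_ord_recl big_ord0 !mxE /=.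
by case: j => [[|[|[|[|[|[|[|j]]]]]]] ltj] //=; rewrite ?f3 ?f4 ?f5 ?f6;
  case: (f 0); case: (f 1); case: (f 2); apply/val_inj.
Qed.

Lemma card_H_E : #|H_E| <= 8.
Proof.
have -> : H_E = [set (D *m H_mx)%R | D : 'rV['F_2]_3].
  apply/setP => e; rewrite inE; apply/submxP/imsetP => [[D ->]|[D _ ->]];
  by exists D.
by apply: leq_trans (leq_imset_card _ _) _; rewrite card_mx card_ord.
Qed.

(* The weight and the three intersection sizes already force linearity. *)
Lemma seven_bits (f : nat -> bool) :
  f 0 + f 1 + f 2 + f 3 + f 4 + f 5 + f 6 = 4 ->
  f 0 + f 3 + f 5 + f 6 = 2 -> f 1 + f 3 + f 4 + f 5 = 2 ->
  f 2 + f 4 + f 5 + f 6 = 2 ->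
  [/\ f 3 = f 0 (+) f 1, f 4 = f 1 (+) f 2,
      f 5 = f 0 (+) f 1 (+) f 2 & f 6 = f 0 (+) f 2].
Proof.
by case: (f 0); case: (f 1); case: (f 2); case: (f 3); case: (f 4);
   case: (f 5); case: (f 6).
Qed.

Lemma card_perm_bits (s : 'S_7) (A : {set 'I_7}) :
  let f k := s (inord k) \in A in
  #|A| = f 0 + f 1 + f 2 + f 3 + f 4 + f 5 + f 6.
Proof.
move=> f; rewrite -sum1_card big_mkcond (reindex_inj (@perm_inj _ s)) /=.
transitivity (\sum_(j < 7) f j : nat).
  by apply: eq_bigr => j _; rewrite /f inord_val; case: (s j \in A).
by rewrite -(big_mkord xpredT (fun j => f j : nat)) !big_nat_recr //= big_geq // add0n.
Qed.

Lemma mem_hamming_aut n (a : 'rV['F_2]_n) (s : 'S_n) :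
  (translation a * coord_perm s)%g \in hamming_aut n.
Proof.
by apply: groupM; apply: mem_gen; rewrite inE; apply/orP; [left|right];
  apply: imset_f.
Qed.

(** * Identification of the code with [H_E] *)

Section EquivalenceToHE.
Variables (C : {set 'rV['F_2]_7}) (x : 'rV['F_2]_7).
Let B := blocks C x.
Hypotheses (Cx : x \in C) (dC : min_dist C = 4) (cB : #|B| = 7).
Hypothesis deg : forall p, degree B [set p] = 4.
Hypothesis cap2 :
  {in B &, forall b c : {set 'I_7}, b != c -> #|b :&: c| = 2}.

Lemma card_code_geq8 : 8 <= #|C|.
Proof.
pose N := [set y in C | hdist x y == min_dist C].
have xN : x \notin N by rewrite inE hdistxx dC andbF.
have <- : #|x |: N| = 8.
  by rewrite cardsU1 xN -(card_imset N (@supp_inj _ x)) [#|_|]cB.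
apply: subset_leq_card; apply/subsetP => y; rewrite !inE.
by case/predU1P => [->|/andP[]].
Qed.

(** If [h = hdist x y] exceeded 4, each of the seven blocks would meet [supp x y] in at most [h / 2]
    points, while these intersections sum to [4 h]. *)
Lemma supp_block y : y \in C -> y != x -> supp x y \in B.
Proof.
move=> Cy yx; apply/imsetP; exists y => //; rewrite inE Cy /=.
apply: contraT => ny; have le4 := min_dist_leq Cx Cy.
rewrite eq_sym yx in le4; have {le4} := le4 isT; rewrite leq_eqVlt.
rewrite eq_sym (negPf ny) /= => lt4.
have capl c : c \in B -> #|supp x y :&: c| <= (hdist x y)./2.
  case/imsetP => z; rewrite inE => /andP[Cz dz] ->; rewrite geq_half_double.
  have := hdist_cardI x y z; rewrite (eqP dz).
  suff /(min_dist_leq Cy Cz) : y != z by lia.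
  by apply: contraNneq ny => ->.
have : \sum_(c in B) #|supp x y :&: c| <= #|B| * (hdist x y)./2.
  by rewrite -sum_nat_const; apply: leq_sum.
rewrite sum_cardI (eq_bigr (fun=> 4)) // sum_nat_const cB.
rewrite -/(hdist x y); move: lt4; rewrite dC; set h := hdist x y.
by clearbody h; clear; lia.
Qed.

Lemma exists_independent_blocks : exists u v w,
  [/\ u \in B, v \in B, w \in B &
     [/\ u != v, u != w, v != w & w != (u :\: v) :|: (v :\: u)]].
Proof.
have /card_gt0P[u Bu] : 0 < #|B| by rewrite cB.
have c6 : #|B :\ u| = 6 by have := cardsD1 u B; rewrite Bu cB => -[].
have /card_gt0P[v Bv] : 0 < #|B :\ u| by rewrite c6.
have c5 : #|B :\ u :\ v| = 5 by have := cardsD1 v (B :\ u); rewrite Bv c6 => -[].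
pose d := (u :\: v) :|: (v :\: u).
have /card_gt0P[w] : 0 < #|B :\ u :\ v :\ d|.
  rewrite lt0n; apply: contra_eqN c5 => /eqP z.
  by rewrite (cardsD1 d) z; case: (d \in _).
rewrite !inE => /and4P[wd wv wu Bw]; move: Bv; rewrite !inE => /andP[vu Bv].
by exists u, v, w; split=> //; split=> //; rewrite eq_sym.
Qed.

Lemma code_equiv_H_E : code_equiv C H_E.
Proof.
have B4 b : b \in B -> #|b| = 4 by move=> /card_blocks->.
have [u [v [w [Bu Bv Bw [uv uw vw nw]]]]] := exists_independent_blocks.
have cells := venn_cells (card_ord 7) (B4 u Bu) (B4 v Bv) (B4 w Bw)
  (cap2 Bu Bv uv) (cap2 Bu Bw uw) (cap2 Bv Bw vw) nw.
have [s0 s0_inj s0E] := H_coordinates (card_ord 7) cells.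
pose s := perm s0_inj.
have sE k : k < 7 -> (s (inord k) \in u, s (inord k) \in v, s (inord k) \in w) =
    nth (true, true, true) H_columns k.
  by move=> k7; rewrite permE s0E inordK.
(* The translation sends [x] to zero; the permutation then turns [u], [v], [w] into the rows of
   [H_mx]. *)
exists (translation x * coord_perm s)%g; first exact: mem_hamming_aut.
(* Since [|H_E| <= 8 <= |C|], inclusion of the image in [H_E] suffices. *)
apply/eqP; rewrite eqEcard; apply/andP; split; last first.
  rewrite card_imset; last exact: perm_inj.
  by apply: leq_trans card_H_E card_code_geq8.
apply/subsetP => _ /imsetP[y Cy ->]; rewrite permM !permE.
pose f k := s (inord k) \in supp x y.
apply: (@H_E_bits _ f) => [j|].
  by rewrite !mxE /f inord_val inE F2_addE.
have [e0 e1 e2 e3] := And4 (sE 0 isT) (sE 1 isT) (sE 2 isT) (sE 3 isT).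
have [e4 e5 e6] := And3 (sE 4 isT) (sE 5 isT) (sE 6 isT).
move: e0 e1 e2 e3 e4 e5 e6 => [u0 v0 w0] [u1 v1 w1] [u2 v2 w2] [u3 v3 w3]
  [u4 v4 w4] [u5 v5 w5] [u6 v6 w6].
have [yx|yx] := eqVneq y x.
  have f0 k : f k = false by rewrite /f inE yx eqxx.
  by rewrite !f0.
have BS := supp_block Cy yx.
have [Su|Su] := eqVneq (supp x y) u.
  by rewrite /f Su u0 u1 u2 u3 u4 u5 u6.
have [Sv|Sv] := eqVneq (supp x y) v.
  by rewrite /f Sv v0 v1 v2 v3 v4 v5 v6.
have [Sw|Sw] := eqVneq (supp x y) w.
  by rewrite /f Sw w0 w1 w2 w3 w4 w5 w6.
(* The support is now a block other than [u], [v], [w], so it meets each of them in two points. *)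
apply: seven_bits.
- by rewrite -[RHS](B4 _ BS) [RHS](card_perm_bits s).
- rewrite -[RHS](cap2 BS Bu Su) [RHS](card_perm_bits s) !in_setI.
  by rewrite u0 u1 u2 u3 u4 u5 u6 !andbF !andbT !addn0.
- rewrite -[RHS](cap2 BS Bv Sv) [RHS](card_perm_bits s) !in_setI.
  by rewrite v0 v1 v2 v3 v4 v5 v6 !andbF !andbT !addn0.
- rewrite -[RHS](cap2 BS Bw Sw) [RHS](card_perm_bits s) !in_setI.
  by rewrite w0 w1 w2 w3 w4 w5 w6 !andbF !andbT !addn0.
Qed.

End EquivalenceToHE.
End Fano.

(** * The repetition code and the final case distinction *)

(** A codeword other than [x] differs from it everywhere, so translation by [x] maps [C] into the
    repetition code; cardinality gives equality. *)
Lemma min_dist_max_repetition n (C : {set 'rV['F_2]_n}) :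
  (1 < #|C|)%N -> (n <= min_dist C)%N ->
  min_dist C = n /\ code_equiv C (repetition_code n).
Proof.
case/card_gt1P => x [y [Cx Cy xy]] ndC; split.
  apply/eqP; rewrite eqn_leq ndC andbT.
  exact: leq_trans (min_dist_leq Cx Cy xy) (hdist_le x y).
exists (translation x).
  by rewrite mem_gen // inE; apply/orP; left; apply: imset_f.
apply/eqP; rewrite eqEcard; apply/andP; split; last first.
  rewrite card_imset; last exact: perm_inj.
  apply: leq_trans (_ : 2 <= _)%N; first by rewrite cards2; case: (_ != _).
  by apply/card_gt1P; exists x, y.
apply/subsetP => _ /imsetP[z Cz ->]; rewrite permE !inE.
have [->|xz] := eqVneq x z.
  by apply/orP; left; apply/eqP/rowP => i; rewrite !mxE F2_addE eqxx.
apply/orP; right; apply/eqP/rowP => i; rewrite !mxE F2_addE.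
have suppT : supp x z = setT.
  apply/eqP; rewrite eqEcard subsetT cardsT card_ord.
  exact: leq_trans ndC (min_dist_leq Cx Cz xz).
by have := in_setT i; rewrite -suppT inE => ->.
Qed.

Theorem theorem1p1 (n : nat) (C : {set 'rV['F_2]_n})
    (hn : (1 <= n)%N)
    (hcr : completely_regular C)
    (hC : (1 < #|C|)%N)
    (hdelta : Num.max 2 (n%:R / 2) < (min_dist C)%:R :> rat) :
  (min_dist C = n /\ code_equiv C (repetition_code n)) \/
  (exists e : n = 7%N,
     min_dist C = 4%N /\
     code_equiv (ecast m {set 'rV['F_2]_m} e C) H_E).
Proof.
have [|ltCn] := leqP n (min_dist C).
  by left; apply: min_dist_max_repetition.
right; move: hdelta; rewrite gt_max ltr_nat ltr_pdivrMr // -natrM ltr_nat muln2.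
case/andP => d2 nd.
have [x [y [Cx Cy dxy]]] := min_dist_attained ltCn.
have d0 : (0 < min_dist C)%N by apply: ltn_trans d2.
have By : supp x y \in blocks C x.
  by apply: imset_f; rewrite inE Cy dxy eqxx.
have [|||||d4 n7 cB deg cap2] := design_parameters _ _ _ _ By d2.
- by move=> b; apply: card_blocks.
- by move=> t; apply: blocks_balanced.
- by move=> b c; apply: blocks_cap.
- by rewrite card_ord.
- by rewrite card_ord.
(* Once 7 replaces [n], the cast is along [erefl] and disappears. *)
rewrite card_ord in n7; move: hcr; subst n => _.
exists erefl; split=> //=.
exact: (code_equiv_H_E Cx d4 cB deg cap2).
Qed.
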